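(* Let $n,k$ be integers with $1\le k\le n-1$ and let $G\in\mathscr{Q}(n,k)$. Then $$SO(G)\le (n-k-1)\sqrt{(n-1)^2+1}+(k-1)\left(\sqrt{k^2+4}+\sqrt{(n-1)^2+4}\right)+\sqrt{k^2+(n-1)^2},$$ with equality if and only if $G\cong Q_{n,k}$.
   Context: All graphs are finite, simple and undirected; $d_G(v)$ is the degree of the vertex $v$ in $G$. The Sombor index of $G$ is $SO(G)=\sum_{uv\in E(G)}\sqrt{d_G(u)^2+d_G(v)^2}$. A connected graph $G$ is a quasi-tree if there is a vertex $u\in V(G)$ such that $G-u$ is a tree. $\mathscr{Q}(n,k)$ denotes the set of quasi-tree graphs $G$ of order $n$ having a vertex $u$ such that $G-u$ is a tree and $d_G(u)=k$ (so $k\ge 1$). $S_m\cong K_{1,m-1}$ is the star of order $m$. $Q_{n,k}$ ($1\le k\le n-1$) is the graph of order $n$ obtained from the star $S_{n-1}$ and a new vertex $v$ by joining $v$ to the center (the $(n-2)$-degree vertex) of $S_{n-1}$ and to $k-1$ of the leaves of $S_{n-1}$. *)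

(* Defs.v *)
From mathcomp Require Import all_boot all_order all_algebra.

Set Implicit Arguments.
Unset Strict Implicit.
Unset Printing Implicit Defensive.

Import Order.TTheory GRing.Theory Num.Theory.

Record sgraph := SGraph {
  vertex :> finType;
  adj : rel vertex;
  adj_sym : symmetric adj;
  adj_irr : irreflexive adj
}.

Definition deg (G : sgraph) (v : G) : nat := #|[set w : G | adj v w]|.

Definition edges (G : sgraph) : {set {set G}} :=
  [set [set x; y] | x in G, y in G & adj x y].

(* An edge has exactly two elements, its endpoints, so the inner sum is
   d(u)^2 + d(v)^2 for the edge uv. *)
Definition sombor (R : rcfType) (G : sgraph) : R :=
  (\sum_(A in edges G) Num.sqrt (\sum_(x in A) (deg x)%:R ^+ 2))%R.

Definition isomorphic (G H : sgraph) : Prop :=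
  exists2 f : G -> H, bijective f & forall x y : G, adj (f x) (f y) = adj x y.

Definition connected (G : sgraph) : Prop :=
  0 < #|G| /\ forall x y : G, connect (@adj G) x y.

(* [ucycle] also accepts the empty sequence and the two traversals of a single
   edge; the cycles of a simple graph are those of length at least 3. *)
Definition acyclic (G : sgraph) : Prop :=
  forall c : seq G, ucycle (@adj G) c -> size c < 3.

Definition tree (G : sgraph) : Prop := connected G /\ acyclic G.

Section DeleteVertex.
Variables (G : sgraph) (u : G).

Definition del_adj : rel {x : G | x != u} := fun x y => adj (val x) (val y).

Lemma del_adj_sym : symmetric del_adj.
Proof. by move=> x y; apply: adj_sym. Qed.

Lemma del_adj_irr : irreflexive del_adj.
Proof. by move=> x; apply: adj_irr. Qed.

Definition del_vertex : sgraph := SGraph del_adj_sym del_adj_irr.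
End DeleteVertex.

Definition quasi_tree (G : sgraph) : Prop :=
  connected G /\ exists u : G, tree (del_vertex u).

Definition quasi_trees (n k : nat) (G : sgraph) : Prop :=
  [/\ quasi_tree G, #|G| = n
    & exists u : G, tree (del_vertex u) /\ deg u = k].

(* The star of order m has center 0 and leaves 1, ..., m - 1. *)
Section Star.
Variable m : nat.

Definition star_adj : rel 'I_m :=
  fun i j => (i == 0 :> nat) != (j == 0 :> nat).

Lemma star_adj_sym : symmetric star_adj.
Proof. by move=> i j; rewrite /star_adj eq_sym. Qed.

Lemma star_adj_irr : irreflexive star_adj.
Proof. by move=> i; rewrite /star_adj eqxx. Qed.

Definition star : sgraph := SGraph star_adj_sym star_adj_irr.
End Star.

(* G with a new vertex None whose neighbourhood is A. *)
Section AddVertex.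
Variables (G : sgraph) (A : {set G}).

Definition add_adj : rel (option G) := fun x y =>
  match x, y with
  | Some a, Some b => adj a b
  | Some a, None | None, Some a => a \in A
  | None, None => false
  end.

Lemma add_adj_sym : symmetric add_adj.
Proof. by move=> [a|] [b|] //=; apply: adj_sym. Qed.

Lemma add_adj_irr : irreflexive add_adj.
Proof. by move=> [a|] //=; apply: adj_irr. Qed.

Definition add_vertex : sgraph := SGraph add_adj_sym add_adj_irr.
End AddVertex.

(* For 1 <= k <= n - 1, the vertices i < k of the star of order n - 1 are its
   center 0 and the k - 1 leaves 1, ..., k - 1. *)
Definition Qgraph (n k : nat) : sgraph :=
  @add_vertex (star (n - 1)) [set i : 'I_(n - 1) | i < k].

(* Main.v *)
(** Let T = G - u, a tree on m = n - 1 vertices, and A the neighbourhood of u,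
    so |A| = k. Adjacent vertices x, y of T have no common neighbour in T, hence
    d(x) + d(y) is at most m plus the number of endpoints in A. By convexity the
    edge xy weighs at most sqrt(m^2 + 4) if both endpoints lie in A, which
    happens for at most k - 1 edges since A spans a forest, and at most
    sqrt(m^2 + 1) otherwise. As T has m - 1 edges and no isolated vertex, the
    excesses d(a) - 2 over a in A sum to at most m - 2, so by convexity of
    t |-> sqrt(k^2 + t^2) the edges at u weigh at most
    (k - 1) sqrt(k^2 + 4) + sqrt(k^2 + m^2), strictly less unless some c in A
    has degree m. Such a vertex c is adjacent to all others, so T is a star
    centred at c and G is Q_{n,k}. *)

Require Import Defs.
From mathcomp Require Import all_boot all_order all_algebra.
From mathcomp Require Import zify ring lra.

Set Implicit Arguments.
Unset Strict Implicit.
Unset Printing Implicit Defensive.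

Import Order.TTheory GRing.Theory Num.Theory.
Local Open Scope ring_scope.

(** * Forests induced on vertex sets *)

(** Induced subgraphs are kept as vertex sets of the ambient graph, so that deleting a leaf in an
    induction does not change the vertex type. *)
Definition degree_in (G : sgraph) (S : {set G}) (x : G) : nat :=
  #|[set y in S | adj x y]|.

Definition acyclic_on (G : sgraph) (S : {set G}) : Prop :=
  forall c : seq G, ucycle (@adj G) c -> {subset c <= S} -> (size c < 3)%N.

Lemma acyclic_onS (G : sgraph) (S S' : {set G}) :
  S' \subset S -> acyclic_on S -> acyclic_on S'.
Proof.
move=> /subsetP sub acS c cyc cS'; apply: acS cyc _ => x /cS'; exact: sub.
Qed.

(** If every vertex of [S] had two neighbours in [S], simple paths inside [S] could be prolonged
    forever, beyond the number of vertices of [G]. *)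
Lemma acyclic_on_leaf (G : sgraph) (S : {set G}) :
  acyclic_on S -> S != set0 -> exists2 x, x \in S & (degree_in S x <= 1)%N.
Proof.
move=> acS /set0Pn[x0 x0S].
suff /exists_inP[x xS dx] : [exists x in S, (degree_in S x <= 1)%N] by exists x.
case: exists_inP => // noleaf.
have deg2 x : x \in S -> (1 < degree_in S x)%N.
  by move=> xS; rewrite ltnNge; apply/negP => dx; apply: noleaf; exists x.
(* A path whose head has a second neighbour either extends or closes a cycle. *)
have long N : exists x p, [/\ uniq (x :: p), path (@adj G) x p,
    {subset x :: p <= S} & size p = N].
  elim: N => [|N [x [p [xpU xpP xpS szp]]]].
    by exists x0, [::]; split=> // y; rewrite inE => /eqP->.
  have xS : x \in S by apply: xpS; rewrite mem_head.
  (* For an empty [p] the default makes [head x p] equal to [x], which is not its own neighbour, so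
     nothing is lost. *)
  have [z zS [xz' zp]] : exists2 z, z \in S & adj x z /\ z != head x p.
    have : [set y in S | adj x y] :\ head x p != set0.
      rewrite -card_gt0; have := deg2 x xS.
      by rewrite /degree_in (cardsD1 (head x p)); case: (_ \in _); lia.
    by case/set0Pn=> z; rewrite !inE => /and3P[? ? ?]; exists z.
  have [zxp|zxp] := boolP (z \in x :: p); last first.
    exists z, (x :: p); split=> //=; first by rewrite zxp.
    - by rewrite adj_sym xz'.
    - by move=> y; rewrite inE => /predU1P[->//|]; apply: xpS.
    - by rewrite szp.
  exfalso; move: zxp; rewrite inE => /predU1P[zx|zinp].
    by move: xz'; rewrite zx adj_irr.
  case/splitPr: zinp zp xpU xpP xpS {szp} => p1 p2 zp xpU xpP xpS.
  case: p1 zp xpU xpP xpS => [|y p1] zp; first by rewrite eqxx in zp.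
  (* As [z] is not the first vertex of the tail, the stretch from [x] to [z] has at least three
     vertices, and the edge [z x] closes it to a cycle. *)
  have -> : (y :: p1) ++ z :: p2 = (y :: rcons p1 z) ++ p2.
    by rewrite /= cat_rcons.
  rewrite -cat_cons cat_uniq cat_path => /andP[xpU _] /andP[xpP _] xpS.
  have /= := acS (x :: y :: rcons p1 z); rewrite size_rcons => H.
  suff: ((size p1).+3 < 3)%N by [].

  apply: H => [|w wi]; last by apply: xpS; rewrite mem_cat wi.
  rewrite /ucycle xpU andbT (cycle_path x) /= last_rcons adj_sym xz'.
  exact: xpP.
have [x [p [/card_uniqP cardp _ _ szp]]] := long #|G|.
by have := max_card (mem (x :: p)); rewrite cardp /= szp ltnn.
Qed.

Lemma degree_in_D1 (G : sgraph) (S : {set G}) (u x : G) :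
  u \in S -> degree_in S x = (adj x u + degree_in (S :\ u) x)%N.
Proof.
move=> uS; rewrite /degree_in (cardsD1 u) !inE uS; congr (_ + _)%N.
by apply: eq_card => y; rewrite !inE andbA.
Qed.

Lemma sum_adj (G : sgraph) (S : {set G}) (x : G) :
  (\sum_(y in S) adj y x)%N = degree_in S x.
Proof.
rewrite /degree_in -sum1_card big_mkcond /= [RHS]big_mkcond /=.
by apply: eq_bigr => y _; rewrite inE adj_sym; case: (y \in S); case: adj.
Qed.

(** Removing a vertex of degree at most 1 lowers the degree sum by at most 2. Only the upper bound
    is kept, since it serves both the tree on [[set~ u]] and the forest spanned by the neighbours of
    [u]. *)
Lemma acyclic_on_handshake (G : sgraph) (S : {set G}) :
  acyclic_on S -> S != set0 ->
  (\sum_(x in S) degree_in S x + 2 <= 2 * #|S|)%N.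
Proof.
move: {2}#|S| (erefl #|S|) => N; elim: N S => [|N IH] S cS acS S0.
  by move: S0; rewrite -card_gt0 cS.
have [x xS dx] := acyclic_on_leaf acS S0.
have cS' : #|S :\ x| = N by move: cS; rewrite (cardsD1 x) xS; lia.
rewrite (big_setD1 x) //= (eq_bigr _ (fun y _ => degree_in_D1 y xS)).
rewrite big_split /= sum_adj cS.
have dE : degree_in S x = degree_in (S :\ x) x.
  by rewrite (degree_in_D1 x xS) adj_irr.
(* The bound fails for the empty set, so the induction has to stop at a singleton. *)
have [S'0|S'0] := eqVneq (S :\ x) set0.
  have d0 : degree_in set0 x = 0%N by apply: eq_card0 => y; rewrite !inE.
  by rewrite dE S'0 big_set0 d0; lia.
have := IH _ cS' (acyclic_onS (subD1set S x) acS) S'0.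
by rewrite cS'; lia.
Qed.

Lemma acyclic_on_triangle (G : sgraph) (S : {set G}) (x y z : G) :
  acyclic_on S -> x \in S -> y \in S -> z \in S ->
  adj x y -> adj y z -> adj z x -> False.
Proof.
move=> acS xS yS zS xy yz zx.
have /= := acS [:: x; y; z]; rewrite ltnn => H.
suff: false by []; apply: H; last first.
  by move=> w; rewrite !inE => /or3P[] /eqP->.
rewrite /ucycle /= xy yz zx !inE negb_or /=; apply/and3P; split=> //.
  apply/andP; split; apply/eqP => E; first by move: xy; rewrite E adj_irr.
  by move: zx; rewrite E adj_irr.
by apply/eqP => E; move: yz; rewrite E adj_irr.
Qed.

(** The two neighbourhoods in [S] are disjoint, because a common neighbour would complete a
    triangle. *)
Lemma acyclic_on_degreeD (G : sgraph) (S : {set G}) (x y : G) :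
  acyclic_on S -> x \in S -> y \in S -> adj x y ->
  (degree_in S x + degree_in S y <= #|S|)%N.
Proof.
move=> acS xS yS xy; rewrite /degree_in -cardsUI.
have -> : [set z in S | adj x z] :&: [set z in S | adj y z] = set0; last first.
  by rewrite cards0 addn0; apply/subset_leq_card/subsetP => z;
    rewrite !inE => /orP[] /andP[].
apply/setP => z; rewrite !inE; apply/negP => /andP[/andP[zS xz] /andP[_ yz]].
by apply: (acyclic_on_triangle acS xS yS zS xy yz); rewrite adj_sym.
Qed.

(** * From the deleted-vertex graph to the vertex set [[set~ u]] *)

Lemma degE (G : sgraph) (u x : G) : deg x = (adj x u + degree_in [set~ u] x)%N.
Proof.
have -> : deg x = degree_in [set: G] x.
  by rewrite /deg /degree_in; apply: eq_card => y; rewrite !inE.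
rewrite (degree_in_D1 x (in_setT u)); congr (_ + _)%N.
by apply: eq_card => y; rewrite !inE andbT.
Qed.

Lemma acyclic_del_vertex (G : sgraph) (u : G) :
  acyclic (del_vertex u) -> acyclic_on [set~ u].
Proof.
move=> ac c cyc cu.
have [c' cE] : exists c' : seq (del_vertex u), c = map val c'.
  elim: c cu {cyc} => [|x c IH] cu; first by exists [::].
  have [|c' ->] := IH; first by move=> y yc; apply: cu; rewrite inE yc orbT.
  have xu : x != u by have := cu x (mem_head _ _); rewrite !inE.
  by exists ((exist _ x xu : del_vertex u) :: c').
rewrite cE size_map; apply: ac.
move: cyc; rewrite /ucycle cE (map_inj_uniq val_inj) => /andP[cyc ->].
by rewrite andbT; move: cyc; rewrite cycle_map.
Qed.

(** With at least three vertices in [G] there is a target other than [x] and [u]; the first step of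
    a path towards it is a neighbour of [x]. *)
Lemma connected_del_vertex_neighbor (G : sgraph) (u x : G) :
  connected (del_vertex u) -> x != u -> (2 < #|G|)%N ->
  (0 < degree_in [set~ u] x)%N.
Proof.
move=> [_ con] xu cG.
have: [set~ u] :\ x != set0.
  rewrite -card_gt0; have := cardsC1 u; rewrite (cardsD1 x) !inE xu; lia.
case/set0Pn=> y; rewrite !inE => /andP[yx yu].
have /connectP[[|[z zu] p] /= pth ly] := con (exist _ x xu) (exist _ y yu).
  by case: ly yx => ->; rewrite eqxx.
rewrite card_gt0; apply/set0Pn; exists z; rewrite !inE zu /=.
by case/andP: pth.
Qed.

(* G - u is a star centred at the neighbour c of u. *)
Definition apex_star (G : sgraph) (u c : G) : Prop :=
  [/\ u != c, adj u c, forall x, x != c -> adj c x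
    & forall x y, x != c -> x != u -> y != c -> y != u -> ~~ adj x y].

(** * The Sombor index as a sum over ordered pairs *)

Section Sombor.
Variable R : rcfType.

(** Each edge is the image of exactly two ordered pairs. Doubling the index avoids choosing an
    orientation of the edges. *)
Lemma sombor_pairs (G : sgraph) :
  sombor R G *+ 2 = \sum_(x : G) \sum_(y : G | adj x y)
    Num.sqrt ((deg x)%:R ^+ 2 + (deg y)%:R ^+ 2).
Proof.
rewrite pair_big_dep /= /sombor -sumrMnl.
rewrite (partition_big (fun p : G * G => [set p.1; p.2]) (mem (edges G))) /=.
  apply: eq_bigr => A /imset2P[x y _]; rewrite inE /= => xy ->.
  have xy' : x != y by apply: contraTneq xy => ->; rewrite adj_irr.
  rewrite (bigD1 (x, y)) /=; last by rewrite xy eqxx.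
  rewrite (bigD1 (y, x)) /=; last first.
    by rewrite adj_sym xy setUC eqxx /= xpair_eqE negb_and eq_sym xy'.
  rewrite [X in _ + (_ + X)]big1 ?addr0 => [|[a b] /=].
    by rewrite big_setU1 ?inE //= big_set1 mulr2n [X in _ + Num.sqrt X]addrC.
  rewrite !xpair_eqE. move=> /andP[/andP[/andP[ab /eqP E] n1] n2].
  have /[!inE] : a \in [set x; y] by rewrite -E !inE eqxx.
  have /[!inE] : b \in [set x; y] by rewrite -E !inE eqxx orbT.
  by do 2!case/orP=> /eqP ?; subst a b; rewrite ?eqxx ?adj_irr in ab n1 n2.
by move=> [x y] /= xy; apply/imset2P; exists x y => //; rewrite inE.
Qed.

Lemma sombor_split (G : sgraph) (u : G) :
  sombor R G *+ 2 =
    (\sum_(y | adj u y) Num.sqrt ((deg u)%:R ^+ 2 + (deg y)%:R ^+ 2)) *+ 2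
  + \sum_(x in [set~ u]) \sum_(y in [set~ u] | adj x y)
      Num.sqrt ((deg x)%:R ^+ 2 + (deg y)%:R ^+ 2).
Proof.
(* Indexing the edges at [u] by all [x != u] lets them be merged termwise with the sums over the
   neighbours of [x]. *)
have E (F : G -> R) :
    \sum_(y | adj u y) F y = \sum_(x | x != u) (if adj x u then F x else 0).
  rewrite -big_mkcondr; apply: eq_bigl => y; rewrite adj_sym.
  by have [->|] := eqVneq y u; rewrite ?adj_irr.
rewrite sombor_pairs (bigD1 u) //= mulr2n -addrA; congr (_ + _).
rewrite E [X in _ = _ + X](eq_bigl (fun x => x != u)); last first.
  by move=> x; rewrite !inE.
rewrite -big_split /=; apply: eq_bigr => x xu.
rewrite big_mkcond (bigD1 u) //=; congr (_ + _).
  by case: ifP => // _; rewrite addrC.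
by rewrite -big_mkcondr /=; apply: eq_bigl => y; rewrite !inE.
Qed.

(** * Convexity and the edges at the deleted vertex *)

(** This is strict convexity of $t \mapsto \sqrt{K^2+t^2}$ with denominators cleared. It reduces to
    the strict Cauchy-Schwarz inequality for the vectors $(K,a)$ and $(K,b)$. *)
Lemma hypot_chord (K a b t : R) : 0 < K -> 0 <= a -> a < t -> t < b ->
  (b - a) * Num.sqrt (K ^+ 2 + t ^+ 2) <
  (b - t) * Num.sqrt (K ^+ 2 + a ^+ 2) + (t - a) * Num.sqrt (K ^+ 2 + b ^+ 2).
Proof.
move=> K0 a0 at_ tb.
have b0 : 0 < b by lra.
have sq (x : R) : 0 <= K ^+ 2 + x ^+ 2 by rewrite addr_ge0 ?sqr_ge0.
have CS : K ^+ 2 + a * b < Num.sqrt (K ^+ 2 + a ^+ 2) * Num.sqrt (K ^+ 2 + b ^+ 2).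
  rewrite -sqrtrM // -[ltLHS]ger0_norm ?addr_ge0 ?sqr_ge0 ?mulr_ge0 ?(ltW b0) //.
  rewrite -sqrtr_sqr ltr_sqrt.
    rewrite -subr_gt0 (_ : _ - _ = (K * (a - b)) ^+ 2); last by ring.
    rewrite exprn_even_gt0 //= mulf_neq0 ?(lt0r_neq0 K0) // subr_eq0.
    by rewrite lt_eqF ?(lt_trans at_ tb).
  by rewrite mulr_gt0 // ltr_wpDr ?sqr_ge0 ?exprn_gt0.
have p0 : 0 < b - t by lra.
have q0 : 0 < t - a by lra.
have r0 : 0 < b - a by lra.
have nneg (c x : R) : 0 < c -> 0 <= c * Num.sqrt x.
  by move=> c0; rewrite mulr_ge0 ?sqrtr_ge0 ?ltW.
rewrite -(ltr_pXn2r (ltn0Sn 1)) ?nnegrE ?addr_ge0 ?nneg //.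
rewrite sqrrD !exprMn !sqr_sqrtr // -subr_gt0.
move: CS; set s := Num.sqrt _; set v := Num.sqrt _; rewrite -subr_gt0 => CS.
(* Since $(b-t)a+(t-a)b=(b-a)t$, the difference of the two squares is $2(b-t)(t-a)(sv-K^2-ab)$. *)
have := mulr_gt0 (mulr_gt0 p0 q0) CS.
rewrite -(pmulr_rgt0 _ (ltr0Sn R 1)).
by congr (_ < _); ring.
Qed.

(** Every term lies below the chord over $[2,m]$, strictly unless [d i] is 2, and the total excess
    over 2 pays for at most one full rise from 2 to [m]. If all [d i] are 2, strictness comes
    instead from [g 2 < g m]. *)
Lemma sum_hypot_lt (I : finType) (A : {set I}) (d : I -> nat) (m : nat) (K : R) :
  0 < K -> A != set0 -> (2 < m)%N -> (forall i, i \in A -> (2 <= d i < m)%N) ->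
  (\sum_(i in A) (d i - 2) <= m - 2)%N ->
  \sum_(i in A) Num.sqrt (K ^+ 2 + (d i)%:R ^+ 2) <
    (#|A|%:R - 1) * Num.sqrt (K ^+ 2 + 4) + Num.sqrt (K ^+ 2 + m%:R ^+ 2).
Proof.
move=> K0 A0 m2 dA sumd; pose g (t : nat) : R := Num.sqrt (K ^+ 2 + t%:R ^+ 2).
have g2E : Num.sqrt (K ^+ 2 + 4) = g 2 by rewrite /g; congr (Num.sqrt (_ + _)); ring.
have g2m : g 2 < g m.
  rewrite /g ltr_sqrt; last by rewrite ltr_wpDr ?sqr_ge0 ?exprn_gt0.
  by rewrite ltrD2l ltr_pXn2r ?nnegrE ?ler0n // ltr_nat.
rewrite g2E -/(g m); under eq_bigr do rewrite -/(g _).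
have m2R : (0 : R) < (m - 2)%:R by rewrite ltr0n subn_gt0.
have natB (t : nat) : (2 <= t)%N -> (t - 2)%:R = t%:R - 2 :> R.
  by move=> t2; rewrite natrB.
have gle i : i \in A -> (m - 2)%:R * g (d i) <=
    (m - 2)%:R * g 2 + (d i - 2)%:R * (g m - g 2) ?= iff (d i == 2)%N.
  move=> iA; have /andP[d2 dm] := dA i iA; rewrite !natB // 1?ltnW //.
  have [->|dn2] := eqVneq (d i) 2; first by rewrite subrr mul0r addr0; apply/leif_refl.
  apply/leifP => /=.
  have dlt : (2 < d i)%N by rewrite ltn_neqAle eq_sym dn2.
  have := @hypot_chord K 2 m%:R (d i)%:R K0 (ler0n _ _).
  rewrite !ltr_nat => /(_ dlt dm); rewrite -![Num.sqrt _]/(g _) => H.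
  apply: lt_le_trans H _; rewrite le_eqVlt; apply/orP; left; apply/eqP.
  by rewrite -/(g _); ring.
have [all2|] := boolP [forall i in A, d i == 2%N].
  rewrite (eq_bigr (fun=> g 2)) => [|i iA]; last first.
    by have /forall_inP/(_ i iA)/eqP-> := all2.
  by rewrite sumr_const -[_ *+ #|_|]mulr_natl; lra.
move=> all2; rewrite -(ltr_pM2l m2R) mulr_sumr.
have [le eqE] := leif_sum gle.
apply: (@lt_le_trans _ _ (\sum_(i in A)
   ((m - 2)%:R * g 2 + (d i - 2)%:R * (g m - g 2)))).
  by rewrite lt_neqAle eqE all2.
rewrite big_split /= sumr_const -mulr_suml -natr_sum -[_ *+ #|A|]mulr_natl.
have : (\sum_(i in A) (d i - 2))%:R <= (m - 2)%:R :> R by rewrite ler_nat.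
move: (\sum_(i in A) _)%:R => D; nra.
Qed.

(** * The value for an apex star and the strict bound otherwise *)

(** The centre [c] has degree [m]. Of the leaves, [k - 1] are joined to [u] and have degree 2, and
    the remaining [m - k] have degree 1. *)
Lemma apex_star_sombor (G : sgraph) (u c : G) (m k : nat) :
  apex_star u c -> #|G| = m.+1 -> deg u = k ->
  sombor R G = (m%:R - k%:R) * Num.sqrt (m%:R ^+ 2 + 1)
    + (k%:R - 1) * (Num.sqrt (k%:R ^+ 2 + 4) + Num.sqrt (m%:R ^+ 2 + 4))
    + Num.sqrt (k%:R ^+ 2 + m%:R ^+ 2).
Proof.
move=> [uc auc ac nadj] cG du.
have cu : c != u by rewrite eq_sym.
have four : 2%:R ^+ 2 = 4 :> R by ring.
have one : 1%:R ^+ 2 = 1 :> R by ring.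
have dc : deg c = m.
  rewrite /deg (_ : [set w | adj c w] = [set~ c]) ?cardsC1 ?cG //.
  apply/setP => x; rewrite !inE; have [->|/ac->//] := eqVneq x c.
  by rewrite adj_irr.
pose S := [set~ u] :\ c.
have inS x : (x \in S) = (x != c) && (x != u) by rewrite !inE.
have dS x : x \in S -> deg x = (adj u x).+1.
  rewrite inS => /andP[xc xu]; have cS : c \in [set~ u] by rewrite !inE.
  rewrite (degE u) (degree_in_D1 x cS) -/S adj_sym [adj x c]adj_sym ac // addnA addn1.
  rewrite [degree_in _ _](_ : _ = 0%N) ?addn0 //.
  apply: eq_card0 => y; rewrite [LHS]inE inS.
  by apply/negP => /andP[/andP[yc yu]]; apply/negP/nadj.
have kE : k = #|[set x in S | adj u x]|.+1.
  rewrite -du /deg (cardsD1 c) inE auc add1n; congr _.+1.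
  apply: eq_card => x; rewrite !inE; have [->|] := eqVneq x u; last by rewrite andbT.
  by rewrite adj_irr !andbF.
have mE : m = (#|[set x in S | adj u x]| + #|[set x in S | ~~ adj u x]|).+1.
  have := cardsC1 u; rewrite cG /= => {1}<-.
  rewrite (cardsD1 c) !inE cu add1n -/S; congr _.+1.
  rewrite -(cardsID [set x | adj u x]); congr (_ + _)%N; apply: eq_card => x.
    by rewrite !inE.
  by rewrite !inE andbC.
have kR : k%:R - 1 = #|[set x in S | adj u x]|%:R :> R by rewrite kE -natr1 addrK.
have mkR : m%:R - k%:R = #|[set x in S | ~~ adj u x]|%:R :> R.
  by rewrite mE kE -!natr1 natrD; ring.
pose f (x y : G) : R := Num.sqrt ((deg x)%:R ^+ 2 + (deg y)%:R ^+ 2).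
have sumu : \sum_(y | adj u y) f u y = Num.sqrt (k%:R ^+ 2 + m%:R ^+ 2)
    + (k%:R - 1) * Num.sqrt (k%:R ^+ 2 + 4).
  rewrite (bigD1 c) //= /f du dc; congr (_ + _).
  rewrite (eq_bigl [in [set x in S | adj u x]]) => [|x]; last first.
    by rewrite !inE; have [->|] := eqVneq x u; rewrite ?adj_irr ?andbF // andbC andbT.
  rewrite (eq_bigr (fun=> Num.sqrt (k%:R ^+ 2 + 4))) => [|x]; last first.
    by rewrite inE => /andP[xS ux]; rewrite dS // ux four.
  by rewrite sumr_const -[_ *+ #|_|]mulr_natl kR.
have sumc : \sum_(y in S) f c y = (m%:R - k%:R) * Num.sqrt (m%:R ^+ 2 + 1)
    + (k%:R - 1) * Num.sqrt (m%:R ^+ 2 + 4).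
  rewrite (bigID (adj u)) /= addrC; congr (_ + _).
    rewrite (eq_bigl [in [set x in S | ~~ adj u x]]) => [|x]; last by rewrite inE.
    rewrite (eq_bigr (fun=> Num.sqrt (m%:R ^+ 2 + 1))) => [|x]; last first.
      by rewrite inE => /andP[xS /negPf ux]; rewrite /f dc dS // ux one.
    by rewrite sumr_const -[_ *+ #|_|]mulr_natl mkR.
  rewrite (eq_bigl [in [set x in S | adj u x]]) => [|x]; last by rewrite inE.
  rewrite (eq_bigr (fun=> Num.sqrt (m%:R ^+ 2 + 4))) => [|x]; last first.
    by rewrite inE => /andP[xS ux]; rewrite /f dc dS // ux four.
  by rewrite sumr_const -[_ *+ #|_|]mulr_natl kR.
suff : sombor R G *+ 2 = (\sum_(y | adj u y) f u y + \sum_(y in S) f c y) *+ 2.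
  by move=> /(pmulrnI (ltn0Sn 1)) ->; rewrite sumu sumc; ring.
rewrite (sombor_split u) mulrnDl; congr (_ + _).
(* Each star edge is met once from [c] and once from its leaf, whose only neighbour other than [u]
   is [c]. *)
rewrite (big_setD1 c) ?inE //= mulr2n; congr (_ + _).
  apply: eq_bigl => x; rewrite !inE andbC; have [->|/ac->//] := eqVneq x c.
  by rewrite adj_irr.
apply: eq_bigr => x xS; move: (xS); rewrite inS => /andP[xc xu].
rewrite (bigD1 c) /=; last by rewrite !inE cu adj_sym ac.
rewrite big1 ?addr0 => [|y /andP[/andP[yu xy] yc]]; first by rewrite /f addrC.
by rewrite !inE in yu; case/negP: (nadj _ _ xc xu yc yu).
Qed.

(** Only the estimate for the edges at [u] needs to be strict. The guard [1 < m] is there because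
    the single vertex of a one-vertex tree is isolated. *)
Lemma sombor_lt (G : sgraph) (u : G) (m : nat) :
  #|G| = m.+1 -> (0 < deg u)%N -> acyclic_on [set~ u] ->
  (forall x, x != u -> (1 < m)%N -> (0 < degree_in [set~ u] x)%N) ->
  (forall x, adj u x -> deg x != m) ->
  sombor R G < (m%:R - (deg u)%:R) * Num.sqrt (m%:R ^+ 2 + 1)
    + ((deg u)%:R - 1)
      * (Num.sqrt ((deg u)%:R ^+ 2 + 4) + Num.sqrt (m%:R ^+ 2 + 4))
    + Num.sqrt ((deg u)%:R ^+ 2 + m%:R ^+ 2).
Proof.
move=> cG du0 acS degS_gt0 degm.
set S := [set~ u] in acS degS_gt0 *.
pose A := [set y | adj u y].
have cA : #|A| = deg u by [].
have cS : #|S| = m by rewrite cardsC1 cG.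
have AS : A \subset S.
  by apply/subsetP => x; rewrite !inE; apply: contraTneq => ->; rewrite adj_irr.
have A0 : A != set0 by rewrite -card_gt0.
have S0 : S != set0 by apply: contraNneq A0 => S0; rewrite -subset0 -S0.
have inA x : (x \in A) = adj x u by rewrite inE adj_sym.
have dE x : deg x = ((x \in A) + degree_in S x)%N by rewrite inA -degE.
have deg_le (x : G) : (deg x <= m)%N.
  have := subset_leq_card (B := [set~ x]) (A := [set y | adj x y]).
  rewrite cardsC1 cG; apply; apply/subsetP => y; rewrite !inE.
  by apply: contraTneq => ->; rewrite adj_irr.
(* For [m] at most 2, any neighbour of [u] would already have degree [m]. *)
have m2 : (2 < m)%N.
  rewrite ltnNge; apply/negP => m2; case/set0Pn: A0 => y yA.
  have yS : y != u by have := subsetP AS y yA; rewrite !inE.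
  have := deg_le y; rewrite leq_eqVlt (negPf (degm y _)) /=; last first.
    by rewrite inE in yA.
  have := degS_gt0 y yS; rewrite dE yA; lia.
have degA x : x \in A -> (2 <= deg x < m)%N.
  move=> xA; have xS : x != u by have := subsetP AS x xA; rewrite !inE.
  rewrite [(deg x < m)%N]ltn_neqAle deg_le // degm ?dE ?xA ?andbT; last by rewrite inE in xA.
  have := degS_gt0 x xS; lia.
have sumS := acyclic_on_handshake acS S0.
(* The tree degrees sum to at most $2m-2$, and the $m-k$ vertices outside [A] take at least 1 each.
   This leaves $m+k-2$ for [A], where [deg x - 2] is the tree degree minus 1. *)
have sumA : (\sum_(x in A) (deg x - 2) <= m - 2)%N.
  have E : (\sum_(x in A) (deg x - 2) + #|A| = \sum_(x in A) degree_in S x)%N.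
    rewrite -sum1_card -big_split /=; apply: eq_bigr => x xA.
    by have := degA x xA; rewrite dE xA; lia.
  have le : (#|S :\: A| <= \sum_(x in S :\: A) degree_in S x)%N.
    rewrite -sum1_card; apply: leq_sum => x; rewrite !inE => /andP[_ xu].
    by apply: degS_gt0; lia.
  move: sumS; rewrite (big_setID A) /= (setIidPr AS) -E cS.
  by move: le; rewrite cardsD (setIidPr AS) cS; have := subset_leq_card AS; lia.
have K0 : (0 : R) < (deg u)%:R by rewrite ltr0n.
have := sum_hypot_lt K0 A0 m2 degA sumA; rewrite cA.
set f1 := Num.sqrt (m%:R ^+ 2 + 1); set f2 := Num.sqrt (m%:R ^+ 2 + 4).
have f12 : 0 <= f2 - f1 by rewrite subr_ge0 /f1 ler_wsqrtr // lerD2l; lra.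
(* The tree degrees are at least 1 and sum to at most [m], so the extreme split is $1$ and $m-1$.
   Adding one for each endpoint in [A] gives at most $m^2+4$ if both are in [A], and at most $m^2+1$
   otherwise. *)
have edge x y : x \in S -> y \in S -> adj x y ->
    Num.sqrt ((deg x)%:R ^+ 2 + (deg y)%:R ^+ 2) <=
    f1 + ((x \in A) && (y \in A))%:R * (f2 - f1).
  move=> xS yS xy; have := acyclic_on_degreeD acS xS yS xy; rewrite cS => dxy.
  have dx0 : (0 < degree_in S x)%N by apply: degS_gt0; rewrite ?inE in xS *; lia.
  have dy0 : (0 < degree_in S y)%N by apply: degS_gt0; rewrite ?inE in yS *; lia.
  have [xyA|xyA] := boolP ((x \in A) && (y \in A)).
    rewrite mul1r [f1 + _]addrC subrK ler_wsqrtr // -!natrX -!natrD ler_nat !dE.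
    case/andP: xyA => -> ->; nia.
  rewrite mul0r addr0 ler_wsqrtr // -[X in _ <= _ + X]/(1%:R) -!natrX -!natrD ler_nat !dE.
  by case: (x \in A) (y \in A) xyA => [] [] //= _; nia.
have sumT : \sum_(x in S) \sum_(y in S | adj x y)
    Num.sqrt ((deg x)%:R ^+ 2 + (deg y)%:R ^+ 2) <=
    ((m%:R - (deg u)%:R) * f1 + ((deg u)%:R - 1) * f2) *+ 2.
  apply: (@le_trans _ _ (\sum_(x in S) \sum_(y in S | adj x y)
      (f1 + ((x \in A) && (y \in A))%:R * (f2 - f1)))).
    apply: ler_sum => x xS; apply: ler_sum => y /andP[yS xy].
    exact: edge.
  have -> : \sum_(x in S) \sum_(y in S | adj x y)
      (f1 + ((x \in A) && (y \in A))%:R * (f2 - f1)) =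
      (\sum_(x in S) degree_in S x)%:R * f1
      + (\sum_(x in A) degree_in A x)%:R * (f2 - f1).
    rewrite (eq_bigr (fun x => (degree_in S x)%:R * f1
        + (if x \in A then (degree_in A x)%:R * (f2 - f1) else 0))) => [|x xS].
      rewrite big_split -big_mkcondr /= !natr_sum !mulr_suml; congr (_ + _).
      apply: eq_bigl => x; have [/(subsetP AS)->//|] := boolP (x \in A).
      by rewrite andbF.
    rewrite big_split /= sumr_const -[_ *+ #|_|]mulr_natl; congr (_ * _ + _).
      by rewrite /degree_in; congr (_%:R); apply: eq_card => y; rewrite [RHS]inE.
    case: (x \in A) => /=; last by apply: big1 => y _; rewrite mul0r.
    rewrite -mulr_suml -natr_sum; congr (_%:R * _).
    rewrite /degree_in -sum1_card big_mkcond [RHS]big_mkcond /=.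
    apply: eq_bigr => y _; rewrite !inE.
    have [->|] := eqVneq y u; first by rewrite adj_irr.
    by case: (adj u y); case: (adj x y).
  (* With at most $m-1$ edges in the tree and $k-1$ inside [A], the total is at most
     $(m-1)f_1+(k-1)(f_2-f_1)=(m-k)f_1+(k-1)f_2$. *)
  have := acyclic_on_handshake (acyclic_onS AS acS) A0.
  rewrite -(ler_nat R) natrD natrM cA; move: (\sum_(x in A) _)%:R => a.
  move: sumS; rewrite -(ler_nat R) natrD natrM cS.
  move: (\sum_(x in S) _)%:R => b Hb Ha.
  have f10 : 0 <= f1 by rewrite sqrtr_ge0.
  clearbody f1 f2; nra.
have := sombor_split u; rewrite -/S [X in _ = X *+ 2 + _](eq_bigl [in A]) => [E|y].
  by move: E sumT; lra.
by rewrite inE.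
Qed.

End Sombor.

(** * Apex stars are the graphs isomorphic to [Qgraph] *)

(** A vertex [c] of full degree is joined to everything, so an edge between two other vertices of
    $G-u$ would form a triangle with it. *)
Lemma apex_star_full_degree (G : sgraph) (u c : G) :
  acyclic_on [set~ u] -> adj u c -> (deg c).+1 = #|G| -> apex_star u c.
Proof.
move=> acS uc dc.
have uNc : u != c by apply: contraTneq uc => ->; rewrite adj_irr.
have ac x : x != c -> adj c x.
  move=> xc; have : [set y | adj c y] = [set~ c].
    apply/eqP; rewrite eqEcard cardsC1 -dc leqnn andbT.
    by apply/subsetP => y; rewrite !inE; apply: contraTneq => ->; rewrite adj_irr.
  by move/setP/(_ x); rewrite !inE xc.
split=> // x y xc xu yc yu; apply/negP => xy.
apply: (acyclic_on_triangle acS _ _ _ xy _ (ac x xc)); rewrite ?inE //.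
  by rewrite eq_sym.
by rewrite adj_sym ac.
Qed.

(** List the vertices other than [u] with [c] first, then the other neighbours of [u], then the
    rest. Positions in this list are the labels in [Qgraph]: position 0 is the centre, and positions
    below [deg u] are the neighbours of the new vertex. *)
Lemma apex_star_isomorphic (G : sgraph) (u c : G) :
  apex_star u c -> isomorphic G (Qgraph #|G| (deg u)).
Proof.
move=> [uc auc ac nadj]; have cu : c != u by rewrite eq_sym.
pose s1 := c :: enum [set x | adj u x & x != c].
pose s2 := enum [set x | ~~ adj u x & x != u].
have s1E x : (x \in s1) = adj u x.
  by rewrite inE mem_enum inE; have [->|] := eqVneq x c; rewrite ?auc ?andbT.
have s2E x : (x \in s2) = ~~ adj u x && (x != u) by rewrite mem_enum inE.
have memE x : (x \in s1 ++ s2) = (x != u).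
  rewrite mem_cat s1E s2E; have [->|] := eqVneq x u; first by rewrite adj_irr.
  by case: adj.
have s1U : uniq s1 by rewrite /= enum_uniq mem_enum inE eqxx andbF.
have sU : uniq (s1 ++ s2).
  rewrite cat_uniq s1U enum_uniq andbT; apply/hasPn => x.
  by rewrite s2E s1E => /andP[].
have ss1 : size s1 = deg u.
  by rewrite -(card_uniqP s1U); apply: eq_card => x; rewrite inE s1E.
have ss : size (s1 ++ s2) = (#|G| - 1)%N.
  rewrite -(card_uniqP sU) subn1 -(cardsC1 u); apply: eq_card => x.
  by rewrite -[LHS]/(x \in s1 ++ s2) memE !inE.
(* The vertex [u] is not listed, so its index is the length [#|G| - 1], which is out of range, and
   [insub] returns [None], the new vertex. *)
pose f x : Qgraph #|G| (deg u) := insub (index x (s1 ++ s2)).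
have fu : f u = None.
  by rewrite /f insubN // -ss index_mem memE eqxx.
have fE x : x != u -> exists2 i : 'I_(#|G| - 1), f x = Some i
    & val i = index x (s1 ++ s2).
  move=> xu; have lt : (index x (s1 ++ s2) < #|G| - 1)%N by rewrite -ss index_mem memE.
  by exists (Ordinal lt) => //; rewrite /f insubT.
have idx1 x : (index x (s1 ++ s2) < deg u)%N = adj u x.
  rewrite index_cat -ss1 -s1E; case: ifP => [|_]; first by rewrite index_mem.
  by rewrite ltnNge leq_addr.
have idx0 x : (index x (s1 ++ s2) == 0)%N = (x == c).
  by rewrite /s1 /= [x == c]eq_sym; case: (c == x).
exists f; last first.
  move=> x y; have [->|xu] := eqVneq x u; have [->|yu] := eqVneq y u.
  - by rewrite fu !adj_irr.
  - by have [j fj vj] := fE y yu; rewrite fu fj /= inE vj idx1.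
  - by have [i fi vi] := fE x xu; rewrite fu fi /= inE vi idx1 adj_sym.
  have [i fi vi] := fE x xu; have [j fj vj] := fE y yu.
  rewrite fi fj /= /star_adj vi vj !idx0.
  have [->|xc] := eqVneq x c; have [->|yc] := eqVneq y c.
  - by rewrite adj_irr.
  - by rewrite ac.
  - by rewrite adj_sym ac.
  - by rewrite (negPf (nadj _ _ xc xu yc yu)).
apply: inj_card_bij => [x y|]; last first.
  rewrite card_option card_ord subn1 prednK //.
  by apply/card_gt0P; exists u.
have [->|xu] := eqVneq x u; have [->|yu] := eqVneq y u => //.
- by have [j -> _] := fE y yu; rewrite fu.
- by have [i -> _] := fE x xu; rewrite fu.
have [i -> vi] := fE x xu; have [j -> vj] := fE y yu => -[ij].
apply: (@index_inj _ x (s1 ++ s2)); rewrite ?memE //.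
by rewrite -vi -vj ij.
Qed.

Lemma Qgraph_apex_star (n k : nat) : (1 <= k <= n - 1)%N ->
  exists u c : Qgraph n k, apex_star u c /\ deg u = k.
Proof.
move=> /andP[k1 kn]; have n1 : (0 < n - 1)%N by lia.
pose z : 'I_(n - 1) := Ordinal n1.
have neq0 (i : 'I_(n - 1)) : Some i != Some z -> (i == 0 :> nat)%N = false.
  by apply: contraNF => /eqP i0; apply/eqP; congr Some; apply: val_inj.
exists None, (Some z); split; first split=> //=.
- by rewrite inE.
- case=> [i|] /= => [/neq0 iz|_]; last by rewrite inE.
  by rewrite /star_adj iz.
- case=> [i|] // [j|] // /neq0 iz _ /neq0 jz _ /=.
  by rewrite /star_adj iz jz.
have inj : injective (fun i : 'I_k => Some (widen_ord kn i)).
  by move=> i j [] /val_inj.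
rewrite -[RHS]card_ord -cardsT -(card_imset _ inj); apply: eq_card => -[i|].
  rewrite !inE /= inE; apply/idP/imsetP => [ik|[j _ [->]]]; last by rewrite /= ltn_ord.
  by exists (Ordinal ik) => //; congr Some; apply: val_inj.
by rewrite !inE; apply/esym/negbTE/negP => /imsetP[].
Qed.

Lemma isomorphic_deg (G H : sgraph) (f : G -> H) (x : G) : bijective f ->
  (forall x y, adj (f x) (f y) = adj x y) -> deg (f x) = deg x.
Proof.
move=> bij fadj; rewrite /deg -(card_imset _ (bij_inj bij)).
have [g fK gK] := bij; apply: eq_card => y; rewrite inE.
apply/idP/imsetP => [xy|[z]]; last by rewrite inE => xz ->; rewrite fadj.
by exists (g y); rewrite ?gK // inE -fadj gK.
Qed.

(** Pulling the apex star structure back to [G] makes [apex_star_sombor] applicable there, in place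
    of a proof that the index is invariant under isomorphism. *)
Lemma isomorphic_apex_star (n k : nat) (G : sgraph) :
  (1 <= k <= n - 1)%N -> isomorphic G (Qgraph n k) ->
  exists u c : G, apex_star u c /\ deg u = k.
Proof.
move=> hk [f bij fadj]; have [u [c [[uc auc ac nadj] du]]] := Qgraph_apex_star hk.
have [g fK gK] := bij; have finj := bij_inj bij.
have neq x v : (x != g v) = (f x != v) by rewrite -(inj_eq finj) gK.
exists (g u), (g c); split; last by rewrite -(isomorphic_deg _ bij fadj) gK.
split; rewrite ?neq -?fadj ?gK // => x; rewrite ?neq; first by rewrite -fadj gK; apply: ac.
by move=> y; rewrite !neq -fadj; apply: nadj.
Qed.

Theorem theorem3p1 (R : rcfType) (n k : nat) (G : sgraph)
    (hk : (1 <= k <= n - 1)%N) (hG : quasi_trees n k G) :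
  let N : R := n%:R in
  let K : R := k%:R in
  let B : R :=
    (N - K - 1) * Num.sqrt ((N - 1) ^+ 2 + 1)
    + (K - 1) * (Num.sqrt (K ^+ 2 + 4) + Num.sqrt ((N - 1) ^+ 2 + 4))
    + Num.sqrt (K ^+ 2 + (N - 1) ^+ 2) in
  sombor R G <= B /\ (sombor R G = B <-> isomorphic G (Qgraph n k)).
Proof.
move=> N K B; have [_ cG [u [[con ac] du]]] := hG.
case: n => [|m] in hk hG N B cG *; first by lia.
have BE : B = (m%:R - k%:R) * Num.sqrt (m%:R ^+ 2 + 1)
    + (k%:R - 1) * (Num.sqrt (k%:R ^+ 2 + 4) + Num.sqrt (m%:R ^+ 2 + 4))
    + Num.sqrt (k%:R ^+ 2 + m%:R ^+ 2).
  by rewrite /B /N /K -natr1 addrK [_ + 1 - _]addrAC addrK.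
have acS := acyclic_del_vertex ac.
have [/exists_inP[c uc /eqP dc]|] := boolP [exists c in [set c | adj u c], deg c == m].
  rewrite inE in uc.
  have uc_star : apex_star u c by apply: apex_star_full_degree; rewrite ?dc ?cG.
  have sB : sombor R G = B by rewrite BE (apex_star_sombor R uc_star cG du).
  split; first by rewrite sB.
  split=> // _; rewrite -cG -du; exact: apex_star_isomorphic uc_star.
move=> /exists_inPn degm.
have lt : sombor R G < B.
  rewrite BE -du; apply: sombor_lt => //; first by rewrite du; lia.
    move=> x xu m1; apply: connected_del_vertex_neighbor => //; rewrite cG; lia.
  by move=> x ux; apply: degm; rewrite inE.
split; first exact: ltW.
split=> [E|iso]; first by rewrite E ltxx in lt.
(* The vertex [u'] may differ from [u]; the contradiction only compares the value of the index with
   the strict bound. *)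
have [u' [c' [star' du']]] := isomorphic_apex_star hk iso.
by rewrite BE (apex_star_sombor R star' cG du') ltxx in lt.
Qed.
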